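(* Let $(\mathcal{A}_n)_{n\in\mathbb N}$ be a sequence of unital Banach algebras such that $\mathrm{Asy}(\mathcal{A}_n)$ is properly infinite. Then there is a $K\ge 1$ and an $N\in\mathbb N$ such that $C_{\mathrm{PI}}(\mathcal{A}_n)\le K$ for all $n\ge N$.
   Context: Banach algebras are complex and have a contractive product $\|ab\|\le\|a\|\|b\|$; a unital Banach algebra has unit $1$ with $\|1\|=1$. For a sequence $(\mathcal A_n)$ of Banach algebras, $\ell^\infty(\mathcal A_n)$ is the Banach algebra of all bounded sequences $(a_n)$ with $a_n\in\mathcal A_n$, with pointwise operations and the supremum norm; $c_0(\mathcal A_n)$ is the closed two-sided ideal of sequences with $\lim_{n\to\infty}\|a_n\|=0$; and $\mathrm{Asy}(\mathcal A_n)=\ell^\infty(\mathcal A_n)/c_0(\mathcal A_n)$ with the quotient norm. Two idempotents $p,q$ in an algebra $\mathcal A$ are equivalent, $p\sim q$, if there are $a,b\in\mathcal A$ with $p=ab$ and $q=ba$; they are orthogonal if $pq=0=qp$. A unital algebra $\mathcal A$ is properly infinite if there are orthogonal idempotents $p,q\in\mathcal A$ with $p\sim 1$ and $q\sim 1$. For a unital Banach algebra $\mathcal A$, $$C_{\mathrm{PI}}(\mathcal A)=\inf\{\|a\|\|b\|\|c\|\|d\| : a,b,c,d\in\mathcal A,\ ab=1=cd,\ ad=0=cb\},$$ with $\inf\emptyset=+\infty$. *)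

(* Defs.v *)
From HB Require Import structures.
From mathcomp Require Import all_boot all_order all_algebra generic_quotient.
From mathcomp Require Import ring_quotient complex.
From mathcomp Require Import all_classical all_reals all_analysis.
Set Implicit Arguments.
Unset Strict Implicit.
Unset Printing Implicit Defensive.
Import Order.TTheory GRing.Theory Num.Theory.
Import numFieldNormedType.Exports.
Local Open Scope classical_set_scope.
Local Open Scope ring_scope.
Local Open Scope quotient_scope.

(** Unital Banach algebras over [K].  The multiplication is part of the mixin,
    rather than inherited from [algType K], because HB provides no join of the
    ring and normed module hierarchies below [numDomainType]; the [algType K]
    instance is declared just after. *)
HB.mixin Record isUnitalBanachAlg (K : numFieldType) A
    of CompleteNormedModule K A := {
  banach_mul : A -> A -> A;
  banach_one : A;
  banach_mulA : associative banach_mul;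
  banach_mul1l : left_id banach_one banach_mul;
  banach_mul1r : right_id banach_one banach_mul;
  banach_mulDl : left_distributive banach_mul +%R;
  banach_mulDr : right_distributive banach_mul +%R;
  banach_scaleAl : forall (k : K) (x y : A),
    k *: banach_mul x y = banach_mul (k *: x) y;
  banach_scaleAr : forall (k : K) (x y : A),
    k *: banach_mul x y = banach_mul x (k *: y);
  banach_normM : forall x y : A, `|banach_mul x y| <= `|x| * `|y|;
  banach_norm1 : `|banach_one| = 1
}.

#[short(type="unitalBanachAlgType")]
HB.structure Definition UnitalBanachAlg (K : numFieldType) :=
  {A of isUnitalBanachAlg K A & CompleteNormedModule K A}.

Section UnitalBanachAlgAlgebra.
Variables (K : numFieldType) (A : unitalBanachAlgType K).

Fact banach_one_neq0 : banach_one != 0 :> A.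
Proof. by rewrite -normr_eq0 banach_norm1 oner_eq0. Qed.

HB.instance Definition _ := GRing.Zmodule_isNzRing.Build
  (UnitalBanachAlg.sort A) banach_mulA banach_mul1l banach_mul1r
  banach_mulDl banach_mulDr banach_one_neq0.

HB.instance Definition _ := GRing.Lmodule_isLalgebra.Build K
  (UnitalBanachAlg.sort A) banach_scaleAl.

HB.instance Definition _ := GRing.Lalgebra_isAlgebra.Build K
  (UnitalBanachAlg.sort A) banach_scaleAr.

End UnitalBanachAlgAlgebra.

(** The norm of a normed module over [R[i]] is valued in [R[i]], with zero
    imaginary part; [rnorm] is the same norm as an element of [R]. *)
Definition rnorm (R : realType) (V : normedModType R[i]) (x : V) : R :=
  complex.Re `|x|.

Section RealNorm.
Variables (R : realType) (V : normedModType R[i]).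
Implicit Types x y : V.

Lemma rnormE x : (rnorm x)%:C%C = `|x|.
Proof. by apply: RRe_real; rewrite normr_real. Qed.

Lemma rnorm_ge0 x : 0 <= rnorm x.
Proof. by rewrite -ler0c rnormE normr_ge0. Qed.

Lemma rnorm0 : rnorm (0 : V) = 0.
Proof. by apply: complexI; rewrite rnormE normr0. Qed.

Lemma rnormN x : rnorm (- x) = rnorm x.
Proof. by apply: complexI; rewrite !rnormE normrN. Qed.

Lemma ler_rnormD x y : rnorm (x + y) <= rnorm x + rnorm y.
Proof. by rewrite -lecR rmorphD /= !rnormE ler_normD. Qed.

Lemma rnormZ (l : R[i]) x : rnorm (l *: x) = complex.Re `|l| * rnorm x.
Proof. by apply: complexI; rewrite rmorphM /= !rnormE normrZ; congr (_ * _). Qed.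

End RealNorm.

Lemma rnormM (R : realType) (A : unitalBanachAlgType R[i]) (x y : A) :
  rnorm (x * y) <= rnorm x * rnorm y.
Proof. by rewrite -lecR rmorphM /= !rnormE banach_normM. Qed.

Lemma rnorm1 (R : realType) (A : unitalBanachAlgType R[i]) :
  rnorm (1 : A) = 1.
Proof. by apply: complexI; rewrite rnormE banach_norm1. Qed.

Section ProperlyInfinite.
Variable A : pzRingType.

Definition idempotent (p : A) := p * p = p.

Definition idem_equiv (p q : A) := exists a b : A, p = a * b /\ q = b * a.

Definition idem_orthogonal (p q : A) := p * q = 0 /\ q * p = 0.

Definition properly_infinite := exists p q : A,
  [/\ idempotent p, idempotent q, idem_orthogonal p q,
      idem_equiv p 1 & idem_equiv q 1].

End ProperlyInfinite.

(** [ereal_inf set0 = +oo]. *)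
Definition C_PI (R : realType) (A : unitalBanachAlgType R[i]) : \bar R :=
  ereal_inf [set x | exists a b c d : A,
    [/\ a * b = 1, c * d = 1, a * d = 0, c * b = 0
      & x = (rnorm a * rnorm b * rnorm c * rnorm d)%:E]].

Definition seqs (R : realType) (A : nat -> unitalBanachAlgType R[i]) : Type :=
  forall n, A n.

Section Sequences.
Variables (R : realType) (A : nat -> unitalBanachAlgType R[i]).
Local Notation S := (seqs A).

HB.instance Definition _ := Choice.copy S (forall n, A n).

Definition seqs_add (a b : S) : S := fun n => a n + b n.
Definition seqs_opp (a : S) : S := fun n => - a n.
Definition seqs_mul (a b : S) : S := fun n => a n * b n.
Definition seqs_scale (l : R[i]) (a : S) : S := fun n => l *: a n.
Definition seqs_zero : S := fun=> 0.
Definition seqs_one : S := fun=> 1.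

Fact seqsP (a b : S) : (forall n, a n = b n) -> a = b.
Proof. exact: functional_extensionality_dep. Qed.

Fact seqs_addA : associative seqs_add.
Proof. by move=> a b c; apply: seqsP => n; exact: addrA. Qed.
Fact seqs_addC : commutative seqs_add.
Proof. by move=> a b; apply: seqsP => n; exact: addrC. Qed.
Fact seqs_add0 : left_id seqs_zero seqs_add.
Proof. by move=> a; apply: seqsP => n; exact: add0r. Qed.
Fact seqs_addN : left_inverse seqs_zero seqs_opp seqs_add.
Proof. by move=> a; apply: seqsP => n; exact: addNr. Qed.

HB.instance Definition _ := GRing.isZmodule.Build S
  seqs_addA seqs_addC seqs_add0 seqs_addN.

Fact seqs_mulA : associative seqs_mul.
Proof. by move=> a b c; apply: seqsP => n; exact: mulrA. Qed.
Fact seqs_mul1l : left_id seqs_one seqs_mul.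
Proof. by move=> a; apply: seqsP => n; exact: mul1r. Qed.
Fact seqs_mul1r : right_id seqs_one seqs_mul.
Proof. by move=> a; apply: seqsP => n; exact: mulr1. Qed.
Fact seqs_mulDl : left_distributive seqs_mul seqs_add.
Proof. by move=> a b c; apply: seqsP => n; exact: mulrDl. Qed.
Fact seqs_mulDr : right_distributive seqs_mul seqs_add.
Proof. by move=> a b c; apply: seqsP => n; exact: mulrDr. Qed.
Fact seqs_one_neq0 : seqs_one != 0.
Proof.
by apply/eqP => /(congr1 (fun a : S => a 0%N)) /eqP; rewrite oner_eq0.
Qed.

HB.instance Definition _ := GRing.Zmodule_isNzRing.Build S
  seqs_mulA seqs_mul1l seqs_mul1r seqs_mulDl seqs_mulDr seqs_one_neq0.

Fact seqs_scaleA l m a : seqs_scale l (seqs_scale m a) = seqs_scale (l * m) a.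
Proof. by apply: seqsP => n; exact: scalerA. Qed.
Fact seqs_scale1 : left_id 1 seqs_scale.
Proof. by move=> a; apply: seqsP => n; exact: scale1r. Qed.
Fact seqs_scaleDr : right_distributive seqs_scale +%R.
Proof. by move=> l a b; apply: seqsP => n; exact: scalerDr. Qed.
Fact seqs_scaleDl a : {morph seqs_scale^~ a : l m / l + m}.
Proof. by move=> l m; apply: seqsP => n; exact: scalerDl. Qed.

HB.instance Definition _ := GRing.Zmodule_isLmodule.Build R[i] S
  seqs_scaleA seqs_scale1 seqs_scaleDr seqs_scaleDl.

Fact seqs_scaleAl (l : R[i]) (a b : S) : l *: (a * b) = l *: a * b.
Proof. by apply: seqsP => n; exact: scalerAl. Qed.
Fact seqs_scaleAr (l : R[i]) (a b : S) : l *: (a * b) = a * (l *: b).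
Proof. by apply: seqsP => n; exact: scalerAr. Qed.

HB.instance Definition _ := GRing.Lmodule_isLalgebra.Build R[i] S seqs_scaleAl.
HB.instance Definition _ := GRing.Lalgebra_isAlgebra.Build R[i] S seqs_scaleAr.

Definition bounded_seqs : {pred S} :=
  fun a => `[< exists M : R, forall n, rnorm (a n) <= M >].

Fact bounded_seqs_subalg : subalg_closed bounded_seqs.
Proof.
split.
- by apply/asboolP; exists 1 => n; rewrite rnorm1.
- move=> l a b /asboolP[M Ma] /asboolP[N Nb]; apply/asboolP.
  exists (complex.Re `|l| * M + N) => n.
  apply: (le_trans (ler_rnormD _ _)); rewrite rnormZ lerD// ler_wpM2l//.
  exact: (@rnorm_ge0 R R[i]^o).
- move=> a b /asboolP[M Ma] /asboolP[N Nb]; apply/asboolP.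
  exists (M * N) => n; apply: (le_trans (rnormM _ _)).
  by rewrite ler_pM ?rnorm_ge0.
Qed.

HB.instance Definition _ := GRing.isSubalgClosed.Build R[i] S bounded_seqs
  (GRing.subalg_closed_semi bounded_seqs_subalg).

Record linf := Linf { linf_val : S ; linf_valP : linf_val \in bounded_seqs }.

HB.instance Definition _ := [isSub for linf_val].
HB.instance Definition _ := [Choice of linf by <:].
HB.instance Definition _ := [SubChoice_isSubAlgebra of linf by <:].

Definition c0 : {pred linf} :=
  fun a => `[< (fun n => rnorm (linf_val a n)) @ \oo --> (0 : R) >].

Fact c0_zmod : zmod_closed c0.
Proof.
split; first by apply/asboolP; under eq_fun do rewrite rnorm0; exact: cvg_cst.
move=> a b /asboolP a0 /asboolP b0; apply/asboolP.
apply: (@squeeze_cvgr _ _ _ _ (cst 0)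
  (fun n => rnorm (linf_val a n) + rnorm (linf_val b n))).
- apply: nearW => n; rewrite rnorm_ge0 /=.
  by rewrite -(rnormN (linf_val b n)) ler_rnormD.
- exact: cvg_cst.
- by rewrite -[X in _ --> X]addr0; exact: cvgD.
Qed.

HB.instance Definition _ := GRing.isZmodClosed.Build linf c0 c0_zmod.

Fact c0Ml (a b : linf) : b \in c0 -> a * b \in c0.
Proof.
move=> /asboolP b0; have /asboolP[M aM] := linf_valP a; apply/asboolP.
apply: (@squeeze_cvgr _ _ _ _ (cst 0) (fun n => M * rnorm (linf_val b n))).
- apply: nearW => n; rewrite rnorm_ge0 /=.
  by apply: (le_trans (rnormM _ _)); rewrite ler_wpM2r ?rnorm_ge0.
- exact: cvg_cst.
- by rewrite -[X in _ --> X](mulr0 M); exact: cvgMr.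
Qed.

Fact c0Mr (a b : linf) : a \in c0 -> a * b \in c0.
Proof.
move=> /asboolP a0; have /asboolP[M bM] := linf_valP b; apply/asboolP.
apply: (@squeeze_cvgr _ _ _ _ (cst 0) (fun n => rnorm (linf_val a n) * M)).
- apply: nearW => n; rewrite rnorm_ge0 /=.
  by apply: (le_trans (rnormM _ _)); rewrite ler_wpM2l ?rnorm_ge0.
- exact: cvg_cst.
- by rewrite -[X in _ --> X](mul0r M); exact: cvgMl.
Qed.

Fact c0Z (l : R[i]) (a : linf) : a \in c0 -> l *: a \in c0.
Proof. by rewrite -mulr_algl; exact: c0Ml. Qed.

Fact c0_1 : 1 \notin c0.
Proof.
apply/asboolP; under eq_fun do rewrite rnorm1.
move=> one0; have /eqP : 1 = 0 :> R.
  by exact: norm_cvg_unique (cvg_cst _) one0.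
by rewrite oner_eq0.
Qed.

(** Only the algebra structures of [linf] and [Asy] are built: proper
    infiniteness does not involve the sup norm or the quotient norm. *)
Definition Asy : Type := Quotient.quot c0.

HB.instance Definition _ := GRing.Zmodule.on Asy.
HB.instance Definition _ := Quotient.on Asy.

Definition Asy_pi (a : linf) : Asy := \pi a.
Definition Asy_one : Asy := Asy_pi 1.
Definition Asy_mul (x y : Asy) : Asy := Asy_pi (repr x * repr y).
Definition Asy_scale (l : R[i]) (x : Asy) : Asy := Asy_pi (l *: repr x).

Fact Asy_pi_eq (a b : linf) : a - b \in c0 -> Asy_pi a = Asy_pi b.
Proof. by rewrite Quotient.idealrBE => /eqP. Qed.

Fact repr_Asy_pi (a : linf) : a - repr (Asy_pi a) \in c0.
Proof. by rewrite Quotient.idealrBE; apply/eqP; rewrite [RHS]reprK. Qed.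

Fact Asy_pi_ind (P : Asy -> Prop) : (forall a, P (Asy_pi a)) -> forall x, P x.
Proof. by move=> h x; rewrite -[x]reprK; exact: h. Qed.

Fact Asy_piD (a b : linf) : Asy_pi a + Asy_pi b = Asy_pi (a + b).
Proof. by rewrite /Asy_pi [RHS]Quotient.pi_add. Qed.

Fact Asy_mulE (a b : linf) : Asy_mul (Asy_pi a) (Asy_pi b) = Asy_pi (a * b).
Proof.
apply/esym/Asy_pi_eq; rewrite -[a * b](subrK (a * repr (Asy_pi b))) -mulrBr.
rewrite -addrA -mulrBl; apply: rpredD; first exact/c0Ml/repr_Asy_pi.
exact/c0Mr/repr_Asy_pi.
Qed.

Fact Asy_scaleE (l : R[i]) (a : linf) : Asy_scale l (Asy_pi a) = Asy_pi (l *: a).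
Proof. by apply/esym/Asy_pi_eq; rewrite -scalerBr c0Z ?repr_Asy_pi. Qed.

Fact Asy_mulA : associative Asy_mul.
Proof.
elim/Asy_pi_ind=> a; elim/Asy_pi_ind=> b; elim/Asy_pi_ind=> c.
by rewrite !Asy_mulE mulrA.
Qed.
Fact Asy_mul1l : left_id Asy_one Asy_mul.
Proof. by elim/Asy_pi_ind=> a; rewrite Asy_mulE mul1r. Qed.
Fact Asy_mul1r : right_id Asy_one Asy_mul.
Proof. by elim/Asy_pi_ind=> a; rewrite Asy_mulE mulr1. Qed.
Fact Asy_mulDl : left_distributive Asy_mul +%R.
Proof.
elim/Asy_pi_ind=> a; elim/Asy_pi_ind=> b; elim/Asy_pi_ind=> c.
by rewrite Asy_piD !Asy_mulE Asy_piD mulrDl.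
Qed.
Fact Asy_mulDr : right_distributive Asy_mul +%R.
Proof.
elim/Asy_pi_ind=> a; elim/Asy_pi_ind=> b; elim/Asy_pi_ind=> c.
by rewrite Asy_piD !Asy_mulE Asy_piD mulrDr.
Qed.
Fact Asy_one_neq0 : Asy_one != 0.
Proof.
apply: contra c0_1 => /eqP q0; rewrite -[1]subr0 Quotient.idealrBE.
by apply/eqP; rewrite [LHS]q0 [RHS]pi_zeror.
Qed.

HB.instance Definition _ := GRing.Zmodule_isNzRing.Build Asy
  Asy_mulA Asy_mul1l Asy_mul1r Asy_mulDl Asy_mulDr Asy_one_neq0.

Fact Asy_scaleA l m x : Asy_scale l (Asy_scale m x) = Asy_scale (l * m) x.
Proof. by elim/Asy_pi_ind: x => a; rewrite !Asy_scaleE scalerA. Qed.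
Fact Asy_scale1 : left_id 1 Asy_scale.
Proof. by elim/Asy_pi_ind=> a; rewrite Asy_scaleE scale1r. Qed.
Fact Asy_scaleDr : right_distributive Asy_scale +%R.
Proof.
move=> l; elim/Asy_pi_ind=> a; elim/Asy_pi_ind=> b.
by rewrite Asy_piD !Asy_scaleE Asy_piD scalerDr.
Qed.
Fact Asy_scaleDl x : {morph Asy_scale^~ x : l m / l + m}.
Proof.
by elim/Asy_pi_ind: x => a l m; rewrite /= !Asy_scaleE Asy_piD scalerDl.
Qed.

HB.instance Definition _ := GRing.Zmodule_isLmodule.Build R[i] Asy
  Asy_scaleA Asy_scale1 Asy_scaleDr Asy_scaleDl.

Fact Asy_scaleAl l x y : Asy_scale l (Asy_mul x y) = Asy_mul (Asy_scale l x) y.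
Proof.
elim/Asy_pi_ind: x => a; elim/Asy_pi_ind: y => b.
by rewrite Asy_mulE !Asy_scaleE Asy_mulE scalerAl.
Qed.
Fact Asy_scaleAr l x y : Asy_scale l (Asy_mul x y) = Asy_mul x (Asy_scale l y).
Proof.
elim/Asy_pi_ind: x => a; elim/Asy_pi_ind: y => b.
by rewrite Asy_mulE !Asy_scaleE Asy_mulE scalerAr.
Qed.

HB.instance Definition _ := GRing.Lmodule_isLalgebra.Build R[i] Asy Asy_scaleAl.
HB.instance Definition _ := GRing.Lalgebra_isAlgebra.Build R[i] Asy Asy_scaleAr.

End Sequences.

(* Main.v *)
(** Equivalence of the orthogonal idempotents p, q with 1 provides elements of
    Asy(A_n) with ba = 1 = dc and bc = 0 = da.  Bounded lifts satisfy these
    relations approximately in A_n for n large, and invertibility of elements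
    close to 1 allows one to correct them to exact relations at a cost in norm
    depending only on the bound of the lifts. *)
Require Import Defs.
From mathcomp Require Import all_boot all_order all_algebra complex.
From mathcomp Require Import all_classical all_reals all_analysis.
From mathcomp Require Import lra.
Import Order.TTheory GRing.Theory Num.Theory.
Import numFieldNormedType.Exports.
Local Open Scope ring_scope.

Lemma rnorm_eq0 (R : realType) (V : normedModType R[i]) (x : V) :
  rnorm x = 0 -> x = 0.
Proof. by move=> x0; apply/eqP; rewrite -normr_eq0 -rnormE x0. Qed.

Lemma rnormB (R : realType) (V : normedModType R[i]) (x y : V) :
  rnorm (x - y) = rnorm (y - x).
Proof. by rewrite -rnormN opprB. Qed.

Lemma complex_gt0 (R : realType) (z : R[i]) :
  0 < z -> exists2 r : R, 0 < r & z = r%:C%C.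
Proof.
by case: z => a b; rewrite ltcE /= => /andP[/eqP-> a0]; exists a.
Qed.

(** Completeness in epsilon form for the real-valued norm. Filters are stated over [R[i]], whose
    positive elements are exactly the positive reals. *)
Lemma rnorm_complete (R : realType) (V : completeNormedModType R[i])
    (u : nat -> V) :
  (forall e : R, 0 < e -> exists m, forall k, rnorm (u (m + k)%N - u m) < e) ->
  exists s : V, forall e : R, 0 < e ->
    exists m, forall k, (m <= k)%N -> rnorm (u k - s) < e.
Proof.
move=> uC.
have /cvg_ex[s us] : cvg (u @ \oo)%classic.
  apply: cauchy_cvg; apply: cauchy_exP => _ /complex_gt0[e e0 ->].
  have [m um] := uC _ e0; exists (u m); exists m => // k /= mk.
  by rewrite -ball_normE /= -rnormE ltcR rnormB -(subnKC mk).
exists s => e e0; move/cvgrPdist_lt: us => /(_ e%:C%C).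
rewrite ltcR => /(_ e0)[m _ um]; exists m => k mk.
by have := um k mk; rewrite /= -rnormE ltcR rnormB.
Qed.

(** Neumann series in [e = 1 - x]; the bound 2 is the geometric sum with ratio 1/2. *)
Lemma inverse_near_one (R : realType) (A : unitalBanachAlgType R[i]) (x : A) :
  rnorm (1 - x) <= 2^-1 ->
  exists y : A, [/\ x * y = 1, y * x = 1 & rnorm y <= 2].
Proof.
have [e xE] : exists e : A, x = 1 - e by exists (1 - x); rewrite subKr.
rewrite xE subKr => e_le {x xE}.
pose u n : A := iter n (fun y => 1 + e * y) 0.
(* [u n] is the partial sum \sum_(k < n) e ^+ k of the Neumann series. *)
have uS n : u n.+1 = 1 + e * u n by [].
(* The mirrored recursion makes the limit a left inverse as well. *)
have uSr n : u n.+1 = 1 + u n * e.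
  elim: n => [|n IH]; first by rewrite /u /= mulr0 mul0r.
  by rewrite uS {1}IH mulrDr mulr1 mulrA uS mulrDl mul1r.
have eM (y : A) : rnorm (e * y) <= 2^-1 * rnorm y.
  by apply: le_trans (rnormM _ _) _; rewrite ler_wpM2r ?rnorm_ge0.
have Me (y : A) : rnorm (y * e) <= rnorm y * 2^-1.
  by apply: le_trans (rnormM _ _) _; rewrite ler_wpM2l ?rnorm_ge0.
have u_le n : rnorm (u n) <= 2.
  elim: n => [|n IH]; first by rewrite rnorm0.
  have := ler_rnormD (1 : A) (e * u n); have := eM (u n); rewrite rnorm1 /=; lra.
(* Each step of the recursion factors one [e] out of the difference, which leaves [e ^+ m * u k]. *)
have uD m k : rnorm (u (m + k)%N - u m) <= 2 * 2^-1 ^+ m.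
  elim: m => [|m IH]; first by rewrite subr0 expr0 mulr1.
  rewrite addSn !uS opprD addrACA subrr add0r -mulrBr exprS.
  have := eM (u (m + k)%N - u m); lra.
have [r r0|s us] := @rnorm_complete R A u.
  have half : `|2^-1 : R| < 1 by rewrite ger0_norm //; lra.
  have /cvgrPdist_lt /(_ (r / 2)) := cvg_expr half.
  have r20 : 0 < r / 2 by lra.
  move=> /(_ r20)[m _ /(_ m (leqnn m))]; rewrite /= sub0r normrN.
  by move=> /ltr_normlW mr; exists m => k; have := uD m k; lra.
have residual (b t : A) : 1 - (s - t) = (1 + b - s) - (b - t).
  by rewrite !opprB !addrA [1 + t - s]addrAC [RHS]addrAC [1 + b - s]addrAC addrK.
(* Passage to the limit: [z] does not depend on [n], while both terms on the right become
   arbitrarily small. With [residual], this applies to [1 - (1 - e) * s] and its mirror image. *)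
have limit0 (z : A) (f : A -> A) :
    (forall y, rnorm (f y) <= 2^-1 * rnorm y) ->
    (forall n, z = (u n.+1 - s) - f (u n - s)) -> z = 0.
  move=> f_le zE; apply/rnorm_eq0/eqP; rewrite eq_le rnorm_ge0 andbT.
  apply/ler_addgt0Pr => r r0; have r20 : 0 < r / 2 by lra.
  have [m um] := us _ r20; rewrite (zE m).
  have := ler_rnormD (u m.+1 - s) (- f (u m - s)); rewrite rnormN.
  have := f_le (u m - s); have := um _ (leqnn m); have := um _ (leqnSn m); lra.
have xs : (1 - e) * s = 1.
  apply/esym/subr0_eq/(limit0 _ (fun y => e * y)) => // n.
  by rewrite uS mulrBr -residual mulrBl mul1r.
have sx : s * (1 - e) = 1.
  apply/esym/subr0_eq/(limit0 _ (fun y => y * e)) => [y|n].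
    by rewrite [leRHS]mulrC.
  by rewrite uSr mulrBl -residual mulrBr mulr1.
exists s; split => //.
(* Taking norms gives a bound of 1 plus half the norm of [s], hence the bound 2. *)
have : s = 1 + e * s by rewrite -xs mulrBl mul1r subrK.
move=> /(congr1 (@rnorm R A)) sE.
have := ler_rnormD (1 : A) (e * s); have := eM s; rewrite -sE rnorm1; lra.
Qed.

(* The matrix [[ba, bc], [da, dc]] is close to the identity.  Block elimination
   replaces [b] by [(ba)^-1 b], clears the entry [bc], rescales [c], and then
   clears the entry [da]; only two inverses are needed. *)
Lemma C_PI_perturbation (R : realType) (A : unitalBanachAlgType R[i])
    (a b c d : A) (M : R) :
  rnorm a <= M -> rnorm b <= M -> rnorm c <= M -> rnorm d <= M ->
  rnorm (1 - b * a) <= 4^-1 -> rnorm (1 - d * c) <= 4^-1 ->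
  rnorm (b * c) <= 4^-1 -> rnorm (d * a) <= 4^-1 ->
  (C_PI A <= (2 * M * M * (M + M * M * (2 * M)) *
              ((M + M * (2 * M * M)) * 2))%:E)%E.
Proof.
move=> aM bM cM dM ba dc bc da.
have nM (x y : A) (r s : R) : rnorm x <= r -> rnorm y <= s ->
    rnorm (x * y) <= r * s.
  by move=> xr ys; apply: le_trans (rnormM _ _) _; rewrite ler_pM ?rnorm_ge0.
have nB (x y : A) (r s : R) : rnorm x <= r -> rnorm y <= s ->
    rnorm (x - y) <= r + s.
  by move=> xr ys; apply: le_trans (ler_rnormD _ _) _; rewrite rnormN lerD.
have [|u [_ u_ba u2]] := @inverse_near_one R A (b * a).
  by apply: le_trans ba _; lra.
pose b1 := u * b.
have b1a : b1 * a = 1 by rewrite /b1 -mulrA.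
have b1M : rnorm b1 <= 2 * M by exact: nM.
pose c1 := c - a * (b1 * c).
have b1c1 : b1 * c1 = 0 by rewrite /c1 mulrBr mulrA b1a mul1r subrr.
have c1M : rnorm c1 <= M + M * (2 * M * M).
  by apply: nB => //; apply: (nM) => //; exact: nM.
have [|v [dc1v _ v2]] := @inverse_near_one R A (d * c1).
  (* The defect is at most 1/4 + (1/4) * 2 * (1/4) = 3/8, so the bound 1/4 on all four entries
     suffices for a second inversion. *)
  have -> : 1 - d * c1 = (1 - d * c) + d * a * (u * (b * c)).
    by rewrite /c1 /b1 mulrBr opprB !mulrA addrA addrAC.
  apply: le_trans (ler_rnormD _ _) _.
  have : rnorm (d * a * (u * (b * c))) <= 4^-1 * (2 * 4^-1).
    by apply: (nM) => //; exact: nM.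
  lra.
pose c2 := c1 * v.
(* Subtracting a multiple of [b1] leaves the product with [c2] unchanged, because [b1 * c2 = 0]. *)
pose d1 := d - d * a * b1.
have b1c2 : b1 * c2 = 0 by rewrite /c2 mulrA b1c1 mul0r.
have d1a : d1 * a = 0 by rewrite /d1 mulrBl -[X in _ - X]mulrA b1a mulr1 subrr.
have d1c2 : d1 * c2 = 1.
  by rewrite /d1 mulrBl -[X in _ - X]mulrA b1c2 mulr0 subr0 /c2 mulrA.
have d1M : rnorm d1 <= M + M * M * (2 * M).
  by apply: nB => //; apply: (nM) => //; exact: nM.
have c2M : rnorm c2 <= (M + M * (2 * M * M)) * 2 by exact: nM.
apply: (@le_trans _ _ (rnorm b1 * rnorm a * rnorm d1 * rnorm c2)%:E).
  by apply: ereal_inf_lbound; exists b1, a, d1, c2; split.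
by rewrite lee_fin !ler_pM ?mulr_ge0 ?rnorm_ge0.
Qed.

(** Equality in the quotient means that the difference is a null sequence. *)
Lemma Asy_pi_eq_near (R : realType) (A : nat -> unitalBanachAlgType R[i])
    (a b : linf A) (e : R) : 0 < e -> Asy_pi a = Asy_pi b ->
  exists N : nat, forall n, (N <= n)%N -> rnorm (linf_val a n - linf_val b n) <= e.
Proof.
move=> e0 /eqP; rewrite -Quotient.idealrBE => /asboolP /cvgrPdist_le /(_ e e0).
move=> [N _ abN]; exists N => n Nn; have := abN n Nn.
by rewrite /= sub0r normrN ger0_norm ?rnorm_ge0.
Qed.

Theorem proposition4p9 (R : realType) (A : nat -> unitalBanachAlgType R[i]) :
  properly_infinite (Asy A) ->
  exists (K : R) (N : nat), 1 <= K /\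
    forall n : nat, (N <= n)%N -> (C_PI (A n) <= K%:E)%E.
Proof.
move=> [p [q [_ _ [pq qp] [a [b [pE ba]]] [c [d [qE dc]]]]]].
(* Compress [p * q = 0], with [p = a * b] and [q = c * d], by [b] on the left and [c] on the right,
   using [b * a = 1 = d * c]. *)
have bc : b * c = 0.
  have : b * (p * q) * c = b * c.
    by rewrite pE qE !mulrA -ba mul1r -mulrA -dc mulr1.
  by rewrite pq mulr0 mul0r.
have da : d * a = 0.
  have : d * (q * p) * a = d * a.
    by rewrite pE qE !mulrA -dc mul1r -mulrA -ba mulr1.
  by rewrite qp mulr0 mul0r.
elim/Asy_pi_ind: a ba da {pE} => a; elim/Asy_pi_ind: b bc => b.
elim/Asy_pi_ind: c dc {qE} => c; elim/Asy_pi_ind: d => d.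
have piM x y : Asy_pi x * Asy_pi y = Asy_pi (x * y) :> Asy A by exact: Asy_mulE.
have pi0 : 0 = Asy_pi (0 : linf A) by rewrite [RHS]pi_zeror.
have e0 : 0 < 4^-1 :> R by lra.
rewrite !piM pi0 => /(@Asy_pi_eq_near R A 1 _ _ e0)[N1 dc].
move=> /(@Asy_pi_eq_near R A _ _ _ e0)[N2 bc] /(@Asy_pi_eq_near R A 1 _ _ e0)[N3 ba].
move=> /(@Asy_pi_eq_near R A _ _ _ e0)[N4 da].
have [Ma aM] := asboolP _ (linf_valP a); have [Mb bM] := asboolP _ (linf_valP b).
have [Mc cM] := asboolP _ (linf_valP c); have [Md dM] := asboolP _ (linf_valP d).
pose M := Num.max (Num.max Ma Mb) (Num.max Mc Md).
pose K := 2 * M * M * (M + M * M * (2 * M)) * ((M + M * (2 * M * M)) * 2).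
(* The maximum with 1 secures the lower bound; beyond the second witness all four relations hold up
   to 1/4. *)
exists (Num.max 1 K), (maxn (maxn N1 N2) (maxn N3 N4)).
split=> [|n]; first by rewrite le_max lexx.
rewrite !geq_max => /andP[/andP[n1 n2] /andP[n3 n4]].
apply: (@le_trans _ _ K%:E); last by rewrite lee_fin le_max lexx orbT.
apply: (@C_PI_perturbation R (A n) (linf_val a n) (linf_val b n)
  (linf_val c n) (linf_val d n)); rewrite ?le_max ?aM ?bM ?cM ?dM ?orbT //.
- exact: ba.
- exact: dc.
- by have := bc n n2; rewrite subr0.
- by have := da n n4; rewrite subr0.
Qed.
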